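(* Let $\alpha=\sigma_1\sigma_2\sigma_3^{-1}\sigma_1\sigma_2^{-1}\sigma_1^{-1}$ and $\beta=\sigma_3\sigma_1^{-1}$ in $B_4$. The braid $\tau=\sigma_1\sigma_2\sigma_3\in B_4$ satisfies $$\rho_4(\tau)=\begin{bmatrix}-t&t&0\\-t&0&t\\-t&0&0\end{bmatrix},$$ and the following equalities hold in $B_4$: $$\alpha=\tau^{-1}\beta\tau,\qquad \alpha^{-1}=\tau\beta\tau^{-1},\qquad \beta^{-1}=\tau^2\beta\tau^{-2}.$$
   Context: $B_4$ is the braid group on four strands with standard generators $\sigma_1,\sigma_2,\sigma_3$ and relations $\sigma_1\sigma_2\sigma_1=\sigma_2\sigma_1\sigma_2$, $\sigma_2\sigma_3\sigma_2=\sigma_3\sigma_2\sigma_3$, $\sigma_1\sigma_3=\sigma_3\sigma_1$. The reduced Burau representation $\rho_4:B_4\to GL(3,\mathbb{Z}[t,t^{-1}])$ is given on generators by $$\rho_4(\sigma_1)=\begin{bmatrix}-t&t&0\\0&1&0\\0&0&1\end{bmatrix},\quad \rho_4(\sigma_2)=\begin{bmatrix}1&0&0\\1&-t&t\\0&0&1\end{bmatrix},\quad \rho_4(\sigma_3)=\begin{bmatrix}1&0&0\\0&1&0\\0&1&-t\end{bmatrix}.$$ The convention is ''left multiplication of matrices'': the matrix of a product of braids is formed by successively multiplying on the left, i.e. in terms of the ordinary matrix product $\rho_4(xy)=\rho_4(y)\rho_4(x)$ for all $x,y\in B_4$; thus $\rho_4(\sigma_1\sigma_2\sigma_3)$ is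 the ordinary matrix product $\rho_4(\sigma_3)\rho_4(\sigma_2)\rho_4(\sigma_1)$. *)

(* Defs.v *)
From HB Require Import structures.
From mathcomp Require Import all_boot all_order all_algebra generic_quotient.
From mathcomp Require Import ring.
From mathcomp Require Import boolp.

Set Implicit Arguments.
Unset Strict Implicit.
Unset Printing Implicit Defensive.

Import GRing.Theory.

Local Open Scope ring_scope.
Local Open Scope quotient_scope.

Local Notation "x %:F" := (FracField.tofrac x) : ring_scope.

(* Z[t, t^-1] is realized inside the field of rational functions, as the
   subring of the fractions p / 'X^n with p an integer polynomial. *)

Definition is_laurent : {pred {fraction {poly int}}} :=
  fun x => `[< exists (p : {poly int}) (n : nat), x = p%:F / ('X^n)%:F >].

Fact Xn_frac_neq0 n : ('X^n)%:F != 0 :> {fraction {poly int}}.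
Proof. by rewrite tofrac_eq0 monic_neq0 ?monicXn. Qed.

Fact is_laurent_subring : subring_closed is_laurent.
Proof.
split.
- apply/asboolP; exists 1, 0%N.
  by rewrite expr0 tofrac1 divr1.
- move=> x y /asboolP[p [n ->]] /asboolP[q [m ->]]; apply/asboolP.
  exists (p * 'X^m - q * 'X^n), (n + m)%N.
  rewrite exprD tofracB !tofracM.
  by rewrite -mulNr addf_div ?Xn_frac_neq0 // mulNr.
- move=> x y /asboolP[p [n ->]] /asboolP[q [m ->]]; apply/asboolP.
  exists (p * q), (n + m)%N.
  by rewrite exprD !tofracM invfM mulrACA.
Qed.

HB.instance Definition _ :=
  GRing.isSubringClosed.Build _ is_laurent is_laurent_subring.

Record laurent := Laurent {
  laurent_val :> {fraction {poly int}};
  laurent_valP : laurent_val \in is_laurent }.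

HB.instance Definition _ := [isSub for laurent_val].
HB.instance Definition _ := [Choice of laurent by <:].
HB.instance Definition _ := [SubChoice_isSubComNzRing of laurent by <:].

Definition laurent_unit : pred laurent :=
  fun x => (x != 0) && ((\val x)^-1 \in is_laurent).

Definition laurent_inv (x : laurent) : laurent :=
  if x != 0 then insubd x (\val x)^-1 else x.

Fact laurent_val1 : laurent_val 1 = 1.
Proof. by []. Qed.

Fact laurent_valM x y : laurent_val (x * y) = laurent_val x * laurent_val y.
Proof. exact: erefl. Qed.

Fact laurent_val_eq0 x : (laurent_val x == 0) = (x == 0).
Proof. exact: (inj_eq (val_inj : injective laurent_val) x 0). Qed.

Fact laurent_val_inv x : laurent_unit x ->
  laurent_val (laurent_inv x) = (laurent_val x)^-1.
Proof.
by move=> /andP[x0 xV]; rewrite /laurent_inv x0 (val_insubd x) xV.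
Qed.

Fact laurent_mulVr : {in laurent_unit, left_inverse 1 laurent_inv *%R}.
Proof.
move=> x xU; apply: val_inj.
rewrite [LHS]laurent_valM [RHS]laurent_val1 laurent_val_inv //.
by rewrite mulVf // laurent_val_eq0; case/andP: xU.
Qed.

Fact laurent_unitPl (x y : laurent) : y * x = 1 -> laurent_unit x.
Proof.
move=> yx.
have v : laurent_val y * laurent_val x = 1.
  by rewrite -laurent_valM yx laurent_val1.
have x0 : laurent_val x != 0.
  by apply: contra_eq_neq v => ->; rewrite mulr0 eq_sym oner_neq0.
apply/andP; split; first by rewrite -laurent_val_eq0.
suff -> : (\val x)^-1 = laurent_val y by exact: laurent_valP.
by rewrite -[LHS]mul1r -v mulfK.
Qed.

Fact laurent_invr_out : {in [predC laurent_unit], laurent_inv =1 id}.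
Proof.
move=> x; rewrite inE; rewrite [_ \in _]/(laurent_unit x).
rewrite /laurent_unit /laurent_inv; case: (x != 0) => //.
rewrite andTb => /negbTE xV.
by apply: val_inj; rewrite (val_insubd x) xV.
Qed.

HB.instance Definition _ := GRing.ComNzRing_hasMulInverse.Build laurent
  laurent_mulVr laurent_unitPl laurent_invr_out.

Fact laurent_X_subproof : 'X%:F \in is_laurent.
Proof. by apply/asboolP; exists 'X, 0%N; rewrite expr0 tofrac1 divr1. Qed.

Fact laurent_XV_subproof : 'X%:F^-1 \in is_laurent.
Proof. by apply/asboolP; exists 1, 1%N; rewrite expr1 tofrac1 div1r. Qed.

Definition t : laurent := Laurent laurent_X_subproof.

Fact t_unit : t \is a GRing.unit.
Proof.
apply/andP; split; last exact: laurent_XV_subproof.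
by rewrite -val_eqE /= tofrac_eq0 polyX_eq0.
Qed.

(* Invertible square matrices of size n.+1, not n. *)
Record GL (R : comUnitRingType) (n : nat) := GLmx {
  GL_mx :> 'M[R]_n.+1;
  GL_mxP : GL_mx \in unitmx }.

HB.instance Definition _ R n := [isSub for @GL_mx R n].
HB.instance Definition _ R n := [Choice of GL R n by <:].

Section GLGroup.
Variables (R : comUnitRingType) (n : nat).
Implicit Types A B C : GL R n.

Fact GL_one_subproof : (1%:M : 'M[R]_n.+1) \in unitmx.
Proof. exact: unitmx1. Qed.

Fact GL_mul_subproof A B : (A : 'M_n.+1) *m B \in unitmx.
Proof. by rewrite unitmx_mul !GL_mxP. Qed.

Fact GL_inv_subproof A : invmx A \in unitmx.
Proof. by rewrite unitmx_inv GL_mxP. Qed.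

Definition GL_one := GLmx GL_one_subproof.
Definition GL_mul A B := GLmx (GL_mul_subproof A B).
Definition GL_inv A := GLmx (GL_inv_subproof A).

Fact GL_mulA : associative GL_mul.
Proof. by move=> A B C; apply: val_inj; rewrite /= mulmxA. Qed.
Fact GL_mul1 : left_id GL_one GL_mul.
Proof. by move=> A; apply: val_inj; rewrite /= mul1mx. Qed.
Fact GL_mulr1 : right_id GL_one GL_mul.
Proof. by move=> A; apply: val_inj; rewrite /= mulmx1. Qed.
Fact GL_mulV : left_inverse GL_one GL_inv GL_mul.
Proof. by move=> A; apply: val_inj; rewrite /= mulVmx ?GL_mxP. Qed.
Fact GL_mulrV : right_inverse GL_one GL_inv GL_mul.
Proof. by move=> A; apply: val_inj; rewrite /= mulmxV ?GL_mxP. Qed.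

HB.instance Definition _ := isGroup.Build (GL R n)
  GL_mulA GL_mul1 GL_mulr1 GL_mulV GL_mulrV.

End GLGroup.

Notation GL3 := (GL laurent 2).

(* The letter [(i, b)] stands for the generator of index i (counted from 0),
   inverted when [b] is true. *)
Definition word := seq ('I_3 * bool).

Definition i0 : 'I_3 := @Ordinal 3 0 isT.
Definition i1 : 'I_3 := @Ordinal 3 1 isT.
Definition i2 : 'I_3 := @Ordinal 3 2 isT.

Definition gen (i : 'I_3) : 'I_3 * bool := (i, false).

Inductive braid_eq : word -> word -> Prop :=
| braid_refl u : braid_eq u u
| braid_sym u v : braid_eq u v -> braid_eq v u
| braid_trans u v w : braid_eq u v -> braid_eq v w -> braid_eq u w
| braid_cat u u' v v' :
    braid_eq u u' -> braid_eq v v' -> braid_eq (u ++ v) (u' ++ v')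
| braid_cancel i b : braid_eq [:: (i, b); (i, ~~ b)] [::]
| braid_121 : braid_eq [:: gen i0; gen i1; gen i0] [:: gen i1; gen i0; gen i1]
| braid_232 : braid_eq [:: gen i1; gen i2; gen i1] [:: gen i2; gen i1; gen i2]
| braid_13 : braid_eq [:: gen i0; gen i2] [:: gen i2; gen i0].

Definition braid_eqb : rel word := fun u v => `[< braid_eq u v >].

Fact braid_eqb_equiv : equiv_class_of braid_eqb.
Proof.
split=> [u|u v|v u w].
- exact/asboolP/braid_refl.
- by apply/asboolP/asboolP; apply: braid_sym.
- by move=> /asboolP uv /asboolP vw; apply/asboolP; apply: braid_trans uv vw.
Qed.

Canonical braid_equiv := EquivRelPack braid_eqb_equiv.

Definition B4 := {eq_quot braid_equiv}.

HB.instance Definition _ : EqQuotient _ braid_equiv B4 := EqQuotient.on B4.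
HB.instance Definition _ := Choice.on B4.

Fact B4_piP u v : reflect (braid_eq u v) (\pi_B4 u == \pi_B4 v).
Proof. by rewrite eqmodE; apply: asboolP. Qed.

Definition word_inv (w : word) : word := rev [seq (l.1, ~~ l.2) | l <- w].

Fact word_mulrV w : braid_eq (w ++ word_inv w) [::].
Proof.
elim: w => [|[i b] w IH]; first exact: braid_refl.
rewrite /word_inv /= rev_cons -cats1 catA -cat1s.
apply: braid_trans (braid_cancel i b).
rewrite -[X in braid_eq _ X]/([:: (i, b)] ++ [::] ++ [:: (i, ~~ b)]).
apply: (braid_cat (braid_refl [:: (i, b)])).
exact: braid_cat IH (braid_refl _).
Qed.

Fact word_invK : involutive word_inv.
Proof.
move=> w; rewrite /word_inv map_rev revK -map_comp -[RHS]map_id.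
by apply: eq_map => -[i b] /=; rewrite negbK.
Qed.

Fact word_mulV w : braid_eq (word_inv w ++ w) [::].
Proof. by rewrite -{2}(word_invK w); apply: word_mulrV. Qed.

Fact braid_eq_repr w : braid_eq (repr (\pi_B4 w)) w.
Proof. by apply/B4_piP; rewrite reprK. Qed.

Definition B4_one : B4 := \pi_B4 [::].
Definition B4_mul (x y : B4) : B4 := \pi_B4 (repr x ++ repr y).
Definition B4_inv (x : B4) : B4 := \pi_B4 (word_inv (repr x)).

Fact B4_mulE u v : B4_mul (\pi_B4 u) (\pi_B4 v) = \pi_B4 (u ++ v).
Proof. by apply/eqP/B4_piP/braid_cat; apply: braid_eq_repr. Qed.

Fact B4_mulA : associative B4_mul.
Proof.
elim/quotP=> u _; elim/quotP=> v _; elim/quotP=> w _.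
by rewrite (B4_mulE v w) (B4_mulE u v) !B4_mulE catA.
Qed.

Fact B4_mul1 : left_id B4_one B4_mul.
Proof. by elim/quotP=> u _; rewrite B4_mulE. Qed.

Fact B4_mulr1 : right_id B4_one B4_mul.
Proof. by elim/quotP=> u _; rewrite B4_mulE cats0. Qed.

Fact B4_mulV : left_inverse B4_one B4_inv B4_mul.
Proof.
elim/quotP=> u eu; rewrite /B4_inv eu B4_mulE.
exact/eqP/B4_piP/word_mulV.
Qed.

Fact B4_mulrV : right_inverse B4_one B4_inv B4_mul.
Proof.
elim/quotP=> u eu; rewrite /B4_inv eu B4_mulE.
exact/eqP/B4_piP/word_mulrV.
Qed.

HB.instance Definition _ := isGroup.Build B4
  B4_mulA B4_mul1 B4_mulr1 B4_mulV B4_mulrV.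

Definition sigma (i : 'I_3) : B4 := \pi_B4 [:: gen i].

Notation sigma1 := (sigma i0).
Notation sigma2 := (sigma i1).
Notation sigma3 := (sigma i2).

Definition mx3 (R : nzRingType) (rows : seq (seq R)) : 'M[R]_3 :=
  \matrix_(i, j) nth 0 (nth [::] rows i) j.

Definition burau_mx (R : comUnitRingType) (t : R) (i : 'I_3) : 'M[R]_3 :=
  match val i with
  | 0 => mx3 [:: [:: - t; t; 0];
                 [:: 0  ; 1; 0];
                 [:: 0  ; 0; 1]]
  | 1 => mx3 [:: [:: 1; 0  ; 0];
                 [:: 1; - t; t];
                 [:: 0; 0  ; 1]]
  | _ => mx3 [:: [:: 1; 0; 0  ];
                 [:: 0; 1; 0  ];
                 [:: 0; 1; - t]]
  end.

Fact mx3_mul (R : comNzRingType)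
    (a b c d e f g h k a' b' c' d' e' f' g' h' k' : R) :
  mx3 [:: [:: a; b; c]; [:: d; e; f]; [:: g; h; k]] *m
  mx3 [:: [:: a'; b'; c']; [:: d'; e'; f']; [:: g'; h'; k']] =
  mx3 [:: [:: a * a' + b * d' + c * g'; a * b' + b * e' + c * h';
              a * c' + b * f' + c * k'];
          [:: d * a' + e * d' + f * g'; d * b' + e * e' + f * h';
              d * c' + e * f' + f * k'];
          [:: g * a' + h * d' + k * g'; g * b' + h * e' + k * h';
              g * c' + h * f' + k * k']].
Proof.
apply/matrixP; do 2 (case=> [[|[|[|//]]] ?]);
  by rewrite !mxE !big_ord_recl big_ord0 !mxE /= addr0 addrA.
Qed.

Fact mx3_id (R : comNzRingType) :
  1%:M = mx3 [:: [:: 1; 0; 0]; [:: 0; 1; 0]; [:: 0; 0; 1]] :> 'M[R]_3.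
Proof. by apply/matrixP; do 2 (case=> [[|[|[|//]]] ?]); rewrite !mxE. Qed.

Local Ltac mx3_congr :=
  congr (mx3 [:: [:: _; _; _]; [:: _; _; _]; [:: _; _; _]]).

Section BurauMatrices.
Variables (R : comUnitRingType) (t : R).

Fact burau_mx_unit i : t \is a GRing.unit -> burau_mx t i \in unitmx.
Proof.
move=> /mulrV tV.
suff [B /mulmx1_unit[]] : exists B, burau_mx t i *m B = 1%:M by [].
case: i => [[|[|[|//]]] ?]; rewrite /burau_mx /=.
- exists (mx3 [:: [:: - t^-1; 1; 0]; [:: 0; 1; 0]; [:: 0; 0; 1]]).
  by rewrite mx3_mul mx3_id; mx3_congr; ring: tV.
- exists (mx3 [:: [:: 1; 0; 0]; [:: t^-1; - t^-1; 1]; [:: 0; 0; 1]]).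
  by rewrite mx3_mul mx3_id; mx3_congr; ring: tV.
- exists (mx3 [:: [:: 1; 0; 0]; [:: 0; 1; 0]; [:: 0; t^-1; - t^-1]]).
  by rewrite mx3_mul mx3_id; mx3_congr; ring: tV.
Qed.

Fact burau_mx_121 :
  burau_mx t i0 *m (burau_mx t i1 *m burau_mx t i0) =
  burau_mx t i1 *m (burau_mx t i0 *m burau_mx t i1).
Proof. by rewrite /burau_mx /= !mx3_mul; mx3_congr; ring. Qed.

Fact burau_mx_232 :
  burau_mx t i1 *m (burau_mx t i2 *m burau_mx t i1) =
  burau_mx t i2 *m (burau_mx t i1 *m burau_mx t i2).
Proof. by rewrite /burau_mx /= !mx3_mul; mx3_congr; ring. Qed.

Fact burau_mx_13 :
  burau_mx t i2 *m burau_mx t i0 = burau_mx t i0 *m burau_mx t i2.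
Proof. by rewrite /burau_mx /= !mx3_mul; mx3_congr; ring. Qed.

End BurauMatrices.

Definition burau_gen (i : 'I_3) : GL3 := GLmx (burau_mx_unit i t_unit).

Definition burau_letter (l : 'I_3 * bool) : GL3 :=
  (if l.2 then (burau_gen l.1)^-1 else burau_gen l.1)%g.

(* Reading a word from left to right, each new factor is multiplied on the
   left, so that concatenation of words becomes the reversed matrix product. *)
Definition burau_word (w : word) : GL3 :=
  foldl (fun A l => burau_letter l * A)%g 1%g w.

Fact burau_word_cat u v : burau_word (u ++ v) = (burau_word v * burau_word u)%g.
Proof.
rewrite /burau_word foldl_cat; set A := foldl _ _ u.
elim/last_ind: v => [|v l IH]; first by rewrite /= mul1g.
by rewrite -cats1 !foldl_cat /= IH mulgA.
Qed.

Fact burau_word_eq u v : braid_eq u v -> burau_word u = burau_word v.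
Proof.
elim=> {u v} // [u v w _ -> _ -> //|u u' v v' _ Hu _ Hv|i b|||].
- by rewrite !burau_word_cat Hu Hv.
- rewrite /burau_word /= mulg1 /burau_letter /=.
  by case: b; rewrite ?mulgV ?mulVg.
- by rewrite /burau_word /= !mulg1; apply: val_inj; apply: burau_mx_121.
- by rewrite /burau_word /= !mulg1; apply: val_inj; apply: burau_mx_232.
- by rewrite /burau_word /= !mulg1; apply: val_inj; apply: burau_mx_13.
Qed.

(* Independent of the chosen representative by [burau_word_eq]. *)
Definition rho4 (x : B4) : GL3 := burau_word (repr x).

Lemma rho4_sigma i : rho4 (sigma i) = burau_gen i.
Proof.
rewrite /rho4 (burau_word_eq (braid_eq_repr _)).
by rewrite /burau_word /= mulg1.
Qed.

Lemma rho4M x y : rho4 (x * y)%g = (rho4 y * rho4 x)%g.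
Proof.
by rewrite /rho4 (burau_word_eq (braid_eq_repr _)) burau_word_cat.
Qed.

(* Main.v *)
Require Import Defs.
From mathcomp Require Import all_boot all_order all_algebra generic_quotient.
From mathcomp Require Import ring.

(** Place the four strands on a circle. Conjugation by
    [tau = sigma1 sigma2 sigma3] is then a rotation by a quarter turn: it sends
    [sigma1] to [sigma2], [sigma2] to [sigma3], [sigma3] to the crossing
    [sigma1 sigma2 sigma3 sigma2^-1 sigma1^-1] that closes the circle, and this
    crossing back to [sigma1] ([tau_sigma1], [tau_sigma2], [tau2_sigma3]). These
    facts hold in any group for three elements satisfying the braid relations.

    A half turn exchanges [sigma1] and [sigma3], and therefore sends
    [beta = sigma3 sigma1^-1] to its inverse ([beta_half_turn]). A quarter turn
    sends [beta] to the closing crossing times [sigma2^-1], which is [alpha^-1]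
    by one braid relation ([beta_quarter_turn]). A quarter turn in the other
    direction differs from this one by a half turn, so it yields the inverse,
    namely [alpha] ([beta_quarter_turnV]).

    The Burau matrix of [tau] is the product of the three generating matrices in
    reversed order. *)

Set Implicit Arguments.
Unset Strict Implicit.

Local Open Scope ring_scope.
Local Open Scope quotient_scope.

Lemma conjgV_intertwine (G : groupType) (g u v : G) :
  (g * u = v * g -> u ^ g^-1 = v)%g.
Proof. by rewrite conjgE invgK mulgA => ->; rewrite mulgK. Qed.

Section BraidTriple.

Local Open Scope group_scope.

Variables (G : groupType) (x y z : G).
Hypotheses (xyx : x * y * x = y * x * y) (yzy : y * z * y = z * y * z).
Hypothesis xz : x * z = z * x.

Let tau := x * y * z.
Let beta := z * x^-1.

Lemma tau_sigma1 : x ^ tau^-1 = y.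
Proof.
apply: conjgV_intertwine; rewrite /tau.
by rewrite -!mulgA -xz !mulgA xyx.
Qed.

Lemma tau_sigma2 : y ^ tau^-1 = z.
Proof.
apply: conjgV_intertwine; rewrite /tau.
by rewrite -!mulgA [y * _]mulgA yzy !mulgA xz.
Qed.

(** Going through the half turn avoids the explicit form of the closing crossing:
    as [tau ^+ 2 = (x y x) (z y z)], the claim is that [z] passes through [z y z]
    as [y], and [y] through [x y x] as [x]. *)
Lemma tau2_sigma3 : (z ^ tau^-1) ^ tau^-1 = x.
Proof.
rewrite -conjgM -invgM; apply: conjgV_intertwine.
have tauE : tau * tau = x * y * x * (z * y * z).
  by rewrite /tau !mulgA -[_ * z * x]mulgA -xz !mulgA.
by rewrite tauE -{1}yzy {2}xyx !mulgA.
Qed.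

Lemma beta_half_turn : (beta ^ tau^-1) ^ tau^-1 = beta^-1.
Proof.
have -> : beta ^ tau^-1 = z ^ tau^-1 * y^-1.
  by rewrite conjMg conjVg tau_sigma1.
by rewrite conjMg conjVg tau2_sigma3 tau_sigma2 invgM invgK.
Qed.

Lemma beta_quarter_turn :
  beta ^ tau^-1 = (x * y * z^-1 * x * y^-1 * x^-1)^-1.
Proof.
rewrite conjMg conjVg tau_sigma1 conjgE invgK /tau !invgM !invgK mulVKg.
(* Once [z] has moved left past [x^-1], the two sides are [x y z] times the
   inverses of the two sides of [xyx]. *)
have xVz : x^-1 * z = z * x^-1 by apply/esym/commuteV.
rewrite -!mulgA; congr (x * (y * _)); rewrite (mulgA x^-1 z) xVz -mulgA.
by congr (z * _); rewrite -!invgM xyx.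
Qed.

(** The two quarter turns of [beta] are a half turn apart, hence inverse to each
    other, so that no new computation with words is needed. *)
Lemma beta_quarter_turnV : beta ^ tau = x * y * z^-1 * x * y^-1 * x^-1.
Proof.
rewrite -[RHS]invgK -beta_quarter_turn.
by rewrite -[beta in LHS]invgK -beta_half_turn conjVg conjgKV.
Qed.

End BraidTriple.

Lemma braid_pi_mul (u v : word) :
  (\pi_B4 u * \pi_B4 v)%g = \pi_B4 (u ++ v)%SEQ.
Proof. exact: B4_mulE. Qed.

Theorem lemma2p1 :
  let alpha : B4 := (sigma1 * sigma2 * sigma3^-1 * sigma1 * sigma2^-1 * sigma1^-1)%g in
  let beta : B4 := (sigma3 * sigma1^-1)%g in
  let tau : B4 := (sigma1 * sigma2 * sigma3)%g in
  (rho4 tau : 'M[laurent]_3) = mx3 [:: [:: - t; t; 0];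
                                       [:: - t; 0; t];
                                       [:: - t; 0; 0]]
  /\ alpha = (tau^-1 * beta * tau)%g
  /\ alpha^-1%g = (tau * beta * tau^-1)%g
  /\ beta^-1%g = (tau ^+ 2 * beta * tau ^- 2)%g.
Proof.
have braid121 : (sigma1 * sigma2 * sigma1 = sigma2 * sigma1 * sigma2)%g.
  by rewrite /sigma !braid_pi_mul; apply/eqP/B4_piP/braid_121.
have braid232 : (sigma2 * sigma3 * sigma2 = sigma3 * sigma2 * sigma3)%g.
  by rewrite /sigma !braid_pi_mul; apply/eqP/B4_piP/braid_232.
have braid13 : (sigma1 * sigma3 = sigma3 * sigma1)%g.
  by rewrite /sigma !braid_pi_mul; apply/eqP/B4_piP/braid_13.
move=> alpha beta tau; split; last split; last split.
- rewrite !rho4M !rho4_sigma /= /burau_mx /= !mx3_mul.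
  by congr (mx3 [:: [:: _; _; _]; [:: _; _; _]; [:: _; _; _]]); ring.
- rewrite -mulgA -conjgE.
  by rewrite (beta_quarter_turnV braid121 braid232 braid13).
- by rewrite -mulgA -(beta_quarter_turn braid121 braid13) conjgE invgK.
- rewrite -(beta_half_turn braid121 braid232 braid13) -conjgM -invgM.
  by rewrite conjgE invgK mulgA expg2.
Qed.
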